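(* Work on the set of $(x,y,z,t,u,v,w,p)\in\mathbb{R}^8$ with $(u,v,w)\neq(0,0,0)$, and write $q=\sqrt{u^2+v^2+w^2}$ and $\mathcal E=p/q^2$. Define the differential forms $$\begin{aligned}B_2=\mathcal E\Big[&\big(1+\tfrac{u^2}{q^2}\big)dx\wedge du+\big(\tfrac{uv}{q^2}+\tfrac wq\big)dx\wedge dv+\big(\tfrac{uw}{q^2}-\tfrac vq\big)dx\wedge dw\\&+\big(\tfrac{uv}{q^2}-\tfrac wq\big)dy\wedge du+\big(1+\tfrac{v^2}{q^2}\big)dy\wedge dv+\big(\tfrac{vw}{q^2}+\tfrac uq\big)dy\wedge dw\\&+\big(\tfrac{uw}{q^2}+\tfrac vq\big)dz\wedge du+\big(\tfrac{vw}{q^2}-\tfrac uq\big)dz\wedge dv+\big(1+\tfrac{w^2}{q^2}\big)dz\wedge dw+dt\wedge dp\Big],\end{aligned}$$ $$\begin{aligned}B_3=\mathcal E\Big[&\tfrac wq\,dx\wedge dy\wedge dp-\tfrac vq\,dx\wedge dz\wedge dp+\tfrac uq\,dy\wedge dz\wedge dp\\&+\tfrac wq\,dt\wedge du\wedge dv-\tfrac vq\,dt\wedge du\wedge dw+\tfrac uq\,dt\wedge dv\wedge dw\Big],\end{aligned}$$ $$\begin{aligned}B_4=\mathcal E\Big[&\big(1-\tfrac{u^2+v^2}{2q^2}\big)dx\wedge dy\wedge du\wedge dv+\big(\tfrac uq-\tfrac{vw}{2q^2}\big)dx\wedge dy\wedge du\wedge dw+\big(\tfrac{uw}{2q^2}+\tfrac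 vq\big)dx\wedge dy\wedge dv\wedge dw\\&-\big(\tfrac{vw}{2q^2}+\tfrac uq\big)dx\wedge dz\wedge du\wedge dv+\big(1-\tfrac{u^2+w^2}{2q^2}\big)dx\wedge dz\wedge du\wedge dw+\big(\tfrac wq-\tfrac{uv}{2q^2}\big)dx\wedge dz\wedge dv\wedge dw\\&+\big(\tfrac{uw}{2q^2}-\tfrac vq\big)dy\wedge dz\wedge du\wedge dv-\big(\tfrac{uv}{2q^2}+\tfrac wq\big)dy\wedge dz\wedge du\wedge dw+\big(1-\tfrac{v^2+w^2}{2q^2}\big)dy\wedge dz\wedge dv\wedge dw\\&+\big(1+\tfrac{u^2}{q^2}\big)dx\wedge dt\wedge du\wedge dp+\big(\tfrac{uv}{q^2}+\tfrac wq\big)dx\wedge dt\wedge dv\wedge dp+\big(\tfrac{uw}{q^2}-\tfrac vq\big)dx\wedge dt\wedge dw\wedge dp\\&+\big(\tfrac{uv}{q^2}-\tfrac wq\big)dy\wedge dt\wedge du\wedge dp+\big(1+\tfrac{v^2}{q^2}\big)dy\wedge dt\wedge dv\wedge dp+\big(\tfrac{vw}{q^2}+\tfrac uq\big)dy\wedge dt\wedge dw\wedge dp\\&+\big(\tfrac{uw}{q^2}+\tfrac vq\big)dz\wedge dt\wedge du\wedge dp+\big(\tfrac{vw}{q^2}-\tfrac uq\big)dz\wedge dt\wedge dv\wedge dp+\big(1+\tfrac{w^2}{q^2}\big)dz\wedge dt\wedge dw\wedge dp\Big],\end{aligned}$$ $$\begin{aligned}B_5=\mathcal E\Big[&\tfrac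 uq\,dx\wedge dy\wedge dz\wedge du\wedge dp+\tfrac vq\,dx\wedge dy\wedge dz\wedge dv\wedge dp+\tfrac wq\,dx\wedge dy\wedge dz\wedge dw\wedge dp\\&+\tfrac uq\,dx\wedge dt\wedge du\wedge dv\wedge dw+\tfrac vq\,dy\wedge dt\wedge du\wedge dv\wedge dw+\tfrac wq\,dz\wedge dt\wedge du\wedge dv\wedge dw\Big],\end{aligned}$$ $$\begin{aligned}B_6=\mathcal E\Big[&dx\wedge dy\wedge dz\wedge du\wedge dv\wedge dw+\big(1-\tfrac{u^2+v^2}{2q^2}\big)dx\wedge dy\wedge dt\wedge du\wedge dv\wedge dp\\&+\big(\tfrac uq-\tfrac{vw}{2q^2}\big)dx\wedge dy\wedge dt\wedge du\wedge dw\wedge dp+\big(\tfrac{uw}{2q^2}+\tfrac vq\big)dx\wedge dy\wedge dt\wedge dv\wedge dw\wedge dp\\&-\big(\tfrac{vw}{2q^2}+\tfrac uq\big)dx\wedge dz\wedge dt\wedge du\wedge dv\wedge dp+\big(1-\tfrac{u^2+w^2}{2q^2}\big)dx\wedge dz\wedge dt\wedge du\wedge dw\wedge dp\\&-\big(\tfrac{uv}{2q^2}-\tfrac wq\big)dx\wedge dz\wedge dt\wedge dv\wedge dw\wedge dp+\big(\tfrac{uw}{2q^2}-\tfrac vq\big)dy\wedge dz\wedge dt\wedge du\wedge dv\wedge dp\\&-\big(\tfrac{uv}{2q^2}+\tfrac wq\big)dy\wedge dz\wedge dt\wedge du\wedge dw\wedge dp+\big(1-\tfrac{v^2+w^2}{2q^2}\big)dy\wedge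 dz\wedge dt\wedge dv\wedge dw\wedge dp\Big],\end{aligned}$$ $$B_8=\mathcal E\,dx\wedge dy\wedge dz\wedge dt\wedge du\wedge dv\wedge dw\wedge dp.$$ Then for each $n\in\{2,3,4,5,6,8\}$ the form $\omega=B_n$ satisfies $$\mathcal L_{\mathcal T}\omega=0,\quad \mathcal L_{\mathcal X}\omega=0,\quad \mathcal L_{\mathcal R_x}\omega=0,\quad \mathcal L_{\mathcal R_y}\omega=0,\quad \mathcal L_{\mathcal R_z}\omega=0,$$ where $\mathcal L$ denotes the Lie derivative. Moreover each $B_n$ is a conserved quantity in the following sense: if $u,v,w,p$ in its coefficient functions are replaced by a solution of the three-dimensional incompressible Navier--Stokes equations of the form $\vec u=\frac xt\mathbf F(\frac yx,\frac zx)$, $p=\frac{x^2}{t^2}F(\frac yx,\frac zx)$ (for $t>0$, $x\neq 0$, where $\vec u\ne0$), the resulting coefficient functions do not depend on $t$.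
   Context: The incompressible Navier--Stokes equations are $\partial_t\vec u+(\vec u\cdot\nabla)\vec u=\nu\Delta\vec u-\nabla p$, $\nabla\cdot\vec u=0$, $\vec u=(u,v,w)$, with $p$ standing for pressure divided by constant density. The vector fields (infinitesimal operators admitted by these equations) are $$\mathcal T=\frac{\partial}{\partial t},\qquad \mathcal X=x\frac{\partial}{\partial x}+y\frac{\partial}{\partial y}+z\frac{\partial}{\partial z}+2t\frac{\partial}{\partial t}-u\frac{\partial}{\partial u}-v\frac{\partial}{\partial v}-w\frac{\partial}{\partial w}-2p\frac{\partial}{\partial p},$$ $$\mathcal R_x=y\frac{\partial}{\partial z}-z\frac{\partial}{\partial y}+v\frac{\partial}{\partial w}-w\frac{\partial}{\partial v},\quad \mathcal R_y=z\frac{\partial}{\partial x}-x\frac{\partial}{\partial z}+w\frac{\partial}{\partial u}-u\frac{\partial}{\partial w},\quad \mathcal R_z=x\frac{\partial}{\partial y}-y\frac{\partial}{\partial x}+u\frac{\partial}{\partial v}-v\frac{\partial}{\partial u},$$ regarded as vector fields on the space with independent coordinates $x,y,z,t,u,v,w,p$. *)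

(* Defs.v *)
From HB Require Import structures.
From mathcomp Require Import all_boot all_order all_algebra.
From mathcomp Require Import all_classical all_reals all_analysis.
Set Implicit Arguments.
Unset Strict Implicit.
Unset Printing Implicit Defensive.
Import Order.TTheory GRing.Theory Num.Theory.
Import numFieldNormedType.Exports.
Local Open Scope classical_set_scope.
Local Open Scope ring_scope.

(* A k-form on R^m, m = n.+1, is given by its values on k-tuples of tangent
   vectors.  The forms used below are combinations of wedge products of
   coordinate differentials, so they are alternating and multilinear. *)
Definition form (R : realType) (n k : nat) : Type :=
  'rV[R]_n.+1 -> ('I_k -> 'rV[R]_n.+1) -> R.

(* dx_(I 0) /\ ... /\ dx_(I (k-1)) on (V 0, ..., V (k-1)), normalised so that
   (dx /\ dy) (V, W) = dx(V) dy(W) - dx(W) dy(V). *)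
Definition dwedge (R : realType) (n k : nat) (I : k.-tuple 'I_n.+1)
    (V : 'I_k -> 'rV[R]_n.+1) : R :=
  \det (\matrix_(a < k, b < k) V b 0 (tnth I a)).

(* The coefficient of w on dx_(I 0) /\ ... /\ dx_(I (k-1)). *)
Definition coefficient (R : realType) (n k : nat) (w : form R n k)
    (I : k.-tuple 'I_n.+1) (z : 'rV[R]_n.+1) : R :=
  w z (fun a => delta_mx 0 (tnth I a)).

Definition pullback (R : realType) (n k : nat)
    (f : 'rV[R]_n.+1 -> 'rV[R]_n.+1) (w : form R n k) : form R n k :=
  fun z V => w (f z) (fun i => 'd f z (V i)).

(* phi is, near (0, z), the flow (s, y) |-> exp(s X) y of the vector field X.
   For smooth X its germ at (0, z) is unique. *)
Definition local_flow (R : realType) (n : nat)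
    (X : 'rV[R]_n.+1 -> 'rV[R]_n.+1) (z : 'rV[R]_n.+1)
    (phi : R -> 'rV[R]_n.+1 -> 'rV[R]_n.+1) : Prop :=
  [/\ \forall y \near z, phi 0 y = y,
      \forall s \near (0 : R) & y \near z,
        is_derive s (1 : R) (phi ^~ y) (X (phi s y)) &
      \forall s \near (0 : R) & y \near z, differentiable (phi s) y].

(* The value at z of the Lie derivative L_X w exists and is eta, where
   L_X w = d/ds (phi_s^* w) at s = 0 for the flow phi of X. *)
Definition is_lie_derivative (R : realType) (n k : nat)
    (X : 'rV[R]_n.+1 -> 'rV[R]_n.+1) (w : form R n k) (z : 'rV[R]_n.+1)
    (eta : ('I_k -> 'rV[R]_n.+1) -> R) : Prop :=
  exists phi : R -> 'rV[R]_n.+1 -> 'rV[R]_n.+1,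
    local_flow X z phi /\
    forall V : 'I_k -> 'rV[R]_n.+1,
      is_derive (0 : R) (1 : R) (fun s : R => pullback (phi s) w z V) (eta V).

(* Coordinates (x, y, z, t, u, v, w, p) on R^8. *)
Definition cx : 'I_8 := @Ordinal 8 0 isT.
Definition cy : 'I_8 := @Ordinal 8 1 isT.
Definition cz : 'I_8 := @Ordinal 8 2 isT.
Definition ct : 'I_8 := @Ordinal 8 3 isT.
Definition cu : 'I_8 := @Ordinal 8 4 isT.
Definition cv : 'I_8 := @Ordinal 8 5 isT.
Definition cw : 'I_8 := @Ordinal 8 6 isT.
Definition cp : 'I_8 := @Ordinal 8 7 isT.

Definition partial (R : realType) (c : 'I_8) : 'rV[R]_8 := delta_mx 0 c.

Definition field_T (R : realType) (m : 'rV[R]_8) : 'rV[R]_8 := partial R ct.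

Definition field_X (R : realType) (m : 'rV[R]_8) : 'rV[R]_8 :=
  m 0 cx *: partial R cx + m 0 cy *: partial R cy + m 0 cz *: partial R cz
  + (2 * m 0 ct) *: partial R ct
  - m 0 cu *: partial R cu - m 0 cv *: partial R cv - m 0 cw *: partial R cw
  - (2 * m 0 cp) *: partial R cp.

Definition field_Rx (R : realType) (m : 'rV[R]_8) : 'rV[R]_8 :=
  m 0 cy *: partial R cz - m 0 cz *: partial R cy
  + m 0 cv *: partial R cw - m 0 cw *: partial R cv.

Definition field_Ry (R : realType) (m : 'rV[R]_8) : 'rV[R]_8 :=
  m 0 cz *: partial R cx - m 0 cx *: partial R cz
  + m 0 cw *: partial R cu - m 0 cu *: partial R cw.

Definition field_Rz (R : realType) (m : 'rV[R]_8) : 'rV[R]_8 :=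
  m 0 cx *: partial R cy - m 0 cy *: partial R cx
  + m 0 cu *: partial R cv - m 0 cv *: partial R cu.

Definition nonzero_velocity (R : realType) : set 'rV[R]_8 :=
  [set m | ~ [/\ m 0 cu = 0, m 0 cv = 0 & m 0 cw = 0]].

Definition speed (R : realType) (m : 'rV[R]_8) : R :=
  Num.sqrt (m 0 cu ^+ 2 + m 0 cv ^+ 2 + m 0 cw ^+ 2).

Definition calE (R : realType) (m : 'rV[R]_8) : R := m 0 cp / speed m ^+ 2.

Definition B2 (R : realType) : form R 7 2 := fun m V =>
  let u := m 0 cu in let v := m 0 cv in let w := m 0 cw in let q := speed m in
  calE m * (
    (1 + u ^+ 2 / q ^+ 2) * dwedge [tuple cx; cu] V
  + (u * v / q ^+ 2 + w / q) * dwedge [tuple cx; cv] V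
  + (u * w / q ^+ 2 - v / q) * dwedge [tuple cx; cw] V
  + (u * v / q ^+ 2 - w / q) * dwedge [tuple cy; cu] V
  + (1 + v ^+ 2 / q ^+ 2) * dwedge [tuple cy; cv] V
  + (v * w / q ^+ 2 + u / q) * dwedge [tuple cy; cw] V
  + (u * w / q ^+ 2 + v / q) * dwedge [tuple cz; cu] V
  + (v * w / q ^+ 2 - u / q) * dwedge [tuple cz; cv] V
  + (1 + w ^+ 2 / q ^+ 2) * dwedge [tuple cz; cw] V
  + dwedge [tuple ct; cp] V).

Definition B3 (R : realType) : form R 7 3 := fun m V =>
  let u := m 0 cu in let v := m 0 cv in let w := m 0 cw in let q := speed m in
  calE m * (
    w / q * dwedge [tuple cx; cy; cp] V
  - v / q * dwedge [tuple cx; cz; cp] V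
  + u / q * dwedge [tuple cy; cz; cp] V
  + w / q * dwedge [tuple ct; cu; cv] V
  - v / q * dwedge [tuple ct; cu; cw] V
  + u / q * dwedge [tuple ct; cv; cw] V).

Definition B4 (R : realType) : form R 7 4 := fun m V =>
  let u := m 0 cu in let v := m 0 cv in let w := m 0 cw in let q := speed m in
  calE m * (
    (1 - (u ^+ 2 + v ^+ 2) / (2 * q ^+ 2)) * dwedge [tuple cx; cy; cu; cv] V
  + (u / q - v * w / (2 * q ^+ 2)) * dwedge [tuple cx; cy; cu; cw] V
  + (u * w / (2 * q ^+ 2) + v / q) * dwedge [tuple cx; cy; cv; cw] V
  - (v * w / (2 * q ^+ 2) + u / q) * dwedge [tuple cx; cz; cu; cv] V
  + (1 - (u ^+ 2 + w ^+ 2) / (2 * q ^+ 2)) * dwedge [tuple cx; cz; cu; cw] V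
  + (w / q - u * v / (2 * q ^+ 2)) * dwedge [tuple cx; cz; cv; cw] V
  + (u * w / (2 * q ^+ 2) - v / q) * dwedge [tuple cy; cz; cu; cv] V
  - (u * v / (2 * q ^+ 2) + w / q) * dwedge [tuple cy; cz; cu; cw] V
  + (1 - (v ^+ 2 + w ^+ 2) / (2 * q ^+ 2)) * dwedge [tuple cy; cz; cv; cw] V
  + (1 + u ^+ 2 / q ^+ 2) * dwedge [tuple cx; ct; cu; cp] V
  + (u * v / q ^+ 2 + w / q) * dwedge [tuple cx; ct; cv; cp] V
  + (u * w / q ^+ 2 - v / q) * dwedge [tuple cx; ct; cw; cp] V
  + (u * v / q ^+ 2 - w / q) * dwedge [tuple cy; ct; cu; cp] V
  + (1 + v ^+ 2 / q ^+ 2) * dwedge [tuple cy; ct; cv; cp] V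
  + (v * w / q ^+ 2 + u / q) * dwedge [tuple cy; ct; cw; cp] V
  + (u * w / q ^+ 2 + v / q) * dwedge [tuple cz; ct; cu; cp] V
  + (v * w / q ^+ 2 - u / q) * dwedge [tuple cz; ct; cv; cp] V
  + (1 + w ^+ 2 / q ^+ 2) * dwedge [tuple cz; ct; cw; cp] V).

Definition B5 (R : realType) : form R 7 5 := fun m V =>
  let u := m 0 cu in let v := m 0 cv in let w := m 0 cw in let q := speed m in
  calE m * (
    u / q * dwedge [tuple cx; cy; cz; cu; cp] V
  + v / q * dwedge [tuple cx; cy; cz; cv; cp] V
  + w / q * dwedge [tuple cx; cy; cz; cw; cp] V
  + u / q * dwedge [tuple cx; ct; cu; cv; cw] V
  + v / q * dwedge [tuple cy; ct; cu; cv; cw] V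
  + w / q * dwedge [tuple cz; ct; cu; cv; cw] V).

Definition B6 (R : realType) : form R 7 6 := fun m V =>
  let u := m 0 cu in let v := m 0 cv in let w := m 0 cw in let q := speed m in
  calE m * (
    dwedge [tuple cx; cy; cz; cu; cv; cw] V
  + (1 - (u ^+ 2 + v ^+ 2) / (2 * q ^+ 2))
      * dwedge [tuple cx; cy; ct; cu; cv; cp] V
  + (u / q - v * w / (2 * q ^+ 2)) * dwedge [tuple cx; cy; ct; cu; cw; cp] V
  + (u * w / (2 * q ^+ 2) + v / q) * dwedge [tuple cx; cy; ct; cv; cw; cp] V
  - (v * w / (2 * q ^+ 2) + u / q) * dwedge [tuple cx; cz; ct; cu; cv; cp] V
  + (1 - (u ^+ 2 + w ^+ 2) / (2 * q ^+ 2))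
      * dwedge [tuple cx; cz; ct; cu; cw; cp] V
  - (u * v / (2 * q ^+ 2) - w / q) * dwedge [tuple cx; cz; ct; cv; cw; cp] V
  + (u * w / (2 * q ^+ 2) - v / q) * dwedge [tuple cy; cz; ct; cu; cv; cp] V
  - (u * v / (2 * q ^+ 2) + w / q) * dwedge [tuple cy; cz; ct; cu; cw; cp] V
  + (1 - (v ^+ 2 + w ^+ 2) / (2 * q ^+ 2))
      * dwedge [tuple cy; cz; ct; cv; cw; cp] V).

Definition B8 (R : realType) : form R 7 8 := fun m V =>
  calE m * dwedge [tuple cx; cy; cz; ct; cu; cv; cw; cp] V.

(* The value in degrees other than 2, 3, 4, 5, 6, 8 is irrelevant. *)
Definition B (R : realType) (n : nat) : form R 7 n :=
  match n as n0 return form R 7 n0 with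
  | 2 => @B2 R
  | 3 => @B3 R
  | 4 => @B4 R
  | 5 => @B5 R
  | 6 => @B6 R
  | 8 => @B8 R
  | _ => fun _ _ => 0
  end.
Arguments B : clear implicits.

(* Space-time R^4 has coordinates (x, y, z, t). *)
Definition event (R : realType) (x y z t : R) : 'rV[R]_4 :=
  \row_(i < 4) [:: x; y; z; t]`_i.

Definition e_space (R : realType) (j : 'I_3) : 'rV[R]_4 :=
  delta_mx 0 (widen_ord (leqnSn 3) j).

Definition e_time (R : realType) : 'rV[R]_4 := delta_mx 0 ord_max.

Definition navier_stokes_at (R : realType) (nu : R)
    (U : 'rV[R]_4 -> 'rV[R]_3) (P : 'rV[R]_4 -> R) (a : 'rV[R]_4) : Prop :=
  [/\ differentiable U a,
      forall j : 'I_3, derivable ('D_(e_space R j) U) a (e_space R j),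
      forall j : 'I_3, derivable P a (e_space R j),
      'D_(e_time R) U a + \sum_(j < 3) U a 0 j *: 'D_(e_space R j) U a
      = nu *: (\sum_(j < 3) 'D_(e_space R j) ('D_(e_space R j) U) a)
        - \row_(j < 3) 'D_(e_space R j) P a &
      \sum_(j < 3) ('D_(e_space R j) U a) 0 j = 0].

(* The point of R^8 obtained by replacing u, v, w, p by U and P. *)
Definition substitute (R : realType) (U : 'rV[R]_4 -> 'rV[R]_3)
    (P : 'rV[R]_4 -> R) (x y z t : R) : 'rV[R]_8 :=
  let a := event x y z t in
  \row_(i < 8) [:: x; y; z; t; U a 0 0; U a 0 1; U a 0 2%:R; P a]`_i.

Definition self_similar (R : realType) (U : 'rV[R]_4 -> 'rV[R]_3)
    (P : 'rV[R]_4 -> R) : Prop :=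
  exists (F : R -> R -> 'rV[R]_3) (G : R -> R -> R),
  forall x y z t : R, 0 < t -> x != 0 ->
    U (event x y z t) = (x / t) *: F (y / x) (z / x) /\
    P (event x y z t) = x ^+ 2 / t ^+ 2 * G (y / x) (z / x).

(* Main.v *)
Require Import Defs.
From HB Require Import structures.
From mathcomp Require Import all_boot all_order all_algebra.
From mathcomp Require Import all_classical all_reals all_analysis.
From mathcomp Require Import ring.
Import Order.TTheory GRing.Theory Num.Theory.
Import numFieldNormedType.Exports.
Local Open Scope classical_set_scope.
Local Open Scope ring_scope.

(** Every [B_n] is [calE] times a combination, built from dot products, traces
and triple products only, of the direction [n = (u, v, w) / q] and of wedge
products of the coordinate differentials; this is [B_invariant_form].  For
instance the coefficient matrix of [dx_i /\ du_j] in [B_2] is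
[1 + n^T n + [n]_x], where [[n]_x] is the matrix of the cross product with [n]
(acting on row vectors, like all matrices below).  In [B_4] and [B_6] this matrix
and [(1 + n^T n) / 2 + [n]_x] occur, the latter once the 2-forms
[dx_(i+1) /\ dx_(i+2)] are used as a basis that rotates like the [dx_i].

Such an expression is invariant under rotations acting simultaneously on
[(x, y, z)] and [(u, v, w)] ([invariant_form_rotation]), because a rotation is
its own cofactor matrix.  It is also invariant under scaling with weights
[1, 2, -1, -2] on space, time, velocity and pressure, because the weights in
each monomial add up to zero ([invariant_form_scale]); and it does not contain
[t].  Since [n] and [calE] are themselves covariant ([motion_similar]), the
group generated by rotations, scalings and time translations preserves every
[B_n] ([B_motion]).

The five vector fields generate one-parameter subgroups of this group, which
give explicit global flows.  Along them the pullback of [B_n] is constant, so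
each Lie derivative exists and vanishes ([lie_derivative_motion]).

For the conservation statement, a self-similar solution at the same place and at
two times has proportional velocities, with a positive factor [a], and pressures
in the ratio [a ^+ 2].  This leaves [n] and [calE] unchanged, hence the
coefficients as well ([B_similar]). *)

(** * Rotations of three-space and alternating maps *)

Section ThreeSpace.
Set Implicit Arguments.
Unset Strict Implicit.
Unset Printing Implicit Defensive.
Variable R : realType.

Definition i0 : 'I_3 := @Ordinal 3 0 isT.
Definition i1 : 'I_3 := @Ordinal 3 1 isT.
Definition i2 : 'I_3 := @Ordinal 3 2 isT.

Lemma ord3P (Q : 'I_3 -> Prop) : Q i0 -> Q i1 -> Q i2 -> forall i, Q i.
Proof.
move=> Q0 Q1 Q2 [[|[|[|//]]] lti].
- by rewrite (_ : Ordinal lti = i0) //; exact: val_inj.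
- by rewrite (_ : Ordinal lti = i1) //; exact: val_inj.
- by rewrite (_ : Ordinal lti = i2) //; exact: val_inj.
Qed.

Lemma ordS3 : (ordS i0 = i1) * (ordS i1 = i2) * (ordS i2 = i0).
Proof. by do !split; exact: val_inj. Qed.

Lemma sum3 (V : nmodType) (F : 'I_3 -> V) :
  \sum_(i < 3) F i = F i0 + F i1 + F i2.
Proof.
rewrite !big_ord_recl big_ord0 addr0 addrA.
by congr (F _ + F _ + F _); exact: val_inj.
Qed.

Definition dot (a b : 'rV[R]_3) : R := \sum_i a 0 i * b 0 i.

(** The second condition says that the matrix is its own cofactor matrix.  For an
orthogonal matrix this amounts to determinant one; it is stated in the form in
which orientation is used, the preservation of cross products. *)
Definition is_rotation (M : 'M[R]_3) : Prop :=
  M *m M^T = 1%:M /\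
  forall k i, M (ordS k) (ordS i) * M (ordS (ordS k)) (ordS (ordS i))
            - M (ordS k) (ordS (ordS i)) * M (ordS (ordS k)) (ordS i) = M k i.

Lemma rotation_col (M : 'M[R]_3) (k l : 'I_3) : is_rotation M ->
  \sum_i M i k * M i l = (k == l)%:R.
Proof.
move=> [/mulmx1C MMT _]; have := congr1 (fun N : 'M[R]_3 => N k l) MMT.
by rewrite !mxE => <-; apply: eq_bigr => i _; rewrite mxE.
Qed.

Lemma dot_rotation (M : 'M[R]_3) (a b : 'rV[R]_3) : is_rotation M ->
  dot (a *m M) (b *m M) = dot a b.
Proof.
move=> [MMT _].
have dotE c d : dot c d = (c *m d^T) 0 0.
  by rewrite !mxE; apply: eq_bigr => i _; rewrite mxE.
by rewrite !dotE trmx_mul mulmxA -(mulmxA a) MMT mulmx1.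
Qed.

Section Alternating.
Variable V : lmodType R.

Definition rotate (M : 'M[R]_3) (x : 'I_3 -> V) (i : 'I_3) : V :=
  \sum_k M k i *: x k.

Definition alternating2 (f : V -> V -> R) : Prop :=
  [/\ forall y, scalar (f^~ y), forall x, scalar (f x) & forall x, f x x = 0].

Definition alternating3 (f : V -> V -> V -> R) : Prop :=
  (forall x, alternating2 (f x))
  /\ (forall z, alternating2 (fun x y => f x y z)).

Lemma scalar_sum (f : V -> R) (c : 'I_3 -> R) (x : 'I_3 -> V) : scalar f ->
  f (\sum_k c k *: x k) = \sum_k c k * f (x k).
Proof.
move=> lf; have f0 : f 0 = 0.
  by have := lf (-1) 0 0; rewrite scaler0 addr0 mulN1r addNr.
by rewrite !sum3 -!addrA !lf -[c i2 *: _]addr0 lf f0 addr0.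
Qed.

Lemma alternating2_swap (f : V -> V -> R) (x y : V) : alternating2 f ->
  f y x = - f x y.
Proof.
move=> [fl fr f0]; have := f0 (1 *: x + y).
rewrite fl !fr !f0 !mul1r add0r addr0 addrC => /eqP.
by rewrite addr_eq0 => /eqP.
Qed.

Lemma scalar_rotate (f : V -> R) M x i : scalar f ->
  f (rotate M x i) = \sum_k M k i * f (x k).
Proof. exact: scalar_sum. Qed.

(** Expanding leaves the values of [f] on the three pairs of distinct vectors,
each multiplied by a 2 by 2 minor of [M], and these minors are the entries of [M].
So the three values of [f] behave like the vectors themselves. *)
Lemma alternating2_rotate (f : V -> V -> R) M x i :
  alternating2 f -> is_rotation M ->
  f (rotate M x (ordS i)) (rotate M x (ordS (ordS i)))
  = \sum_k M k i * f (x (ordS k)) (x (ordS (ordS k))).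
Proof.
move=> altf [_ cofM]; have [fl fr f0] := altf.
rewrite (scalar_rotate M x _ (fl _)).
under eq_bigr => k _ do rewrite (scalar_rotate M x _ (fr _)).
rewrite !sum3 -(cofM i0 i) -(cofM i1 i) -(cofM i2 i) !ordS3 !f0.
rewrite (alternating2_swap (x i0) (x i1) altf).
rewrite (alternating2_swap (x i1) (x i2) altf).
by rewrite (alternating2_swap (x i2) (x i0) altf); ring.
Qed.

(** Expanding the last two slots by [alternating2_rotate] and then the first one
leaves the squared norm of a column of [M]. *)
Lemma alternating3_rotate (f : V -> V -> V -> R) M x :
  alternating3 f -> is_rotation M ->
  f (rotate M x i0) (rotate M x i1) (rotate M x i2) = f (x i0) (x i1) (x i2).
Proof.
move=> [altr altl] rotM.
have := alternating2_rotate x i0 (altr (rotate M x i0)) rotM.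
rewrite !ordS3 => ->.
have fl y z : scalar (fun w => f w y z) by have [+ _ _] := altl z; exact.
under eq_bigr => k _ do rewrite (scalar_rotate M x _ (fl _ _)).
have := rotation_col i0 i0 rotM; rewrite eqxx !sum3 !ordS3 => M1.
have fxx z y : f y y z = 0 by have [_ _] := altl z.
have fxyx y z : f y z y = 0.
  by rewrite (alternating2_swap _ _ (altr y)) fxx oppr0.
rewrite !fxx !fxyx.
rewrite (alternating2_swap (x i0) (x i2) (altr (x i1))).
rewrite (alternating2_swap (x i0) (x i1) (altl (x i2))).
rewrite (alternating2_swap (x i0) (x i2) (altl (x i1))).
rewrite (alternating2_swap (x i1) (x i2) (altr (x i0))).
rewrite -[RHS]mul1r (_ : 1 = true%:R) // -M1; ring.
Qed.
End Alternating.

(** The vector of the antisymmetric part of [W]. *)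
Definition axial (W : 'M[R]_3) : 'rV[R]_3 :=
  \row_i (W (ordS i) (ordS (ordS i)) - W (ordS (ordS i)) (ordS i)).

(** The pairing of [W] with the matrix [alpha (1 + n^T n) + [n]_x], where [[n]_x]
is the matrix of the cross product with [n]. *)
Definition contraction (alpha : R) (n : 'rV[R]_3) (W : 'M[R]_3) : R :=
  alpha * (\tr W + (n *m W *m n^T) 0 0) + dot n (axial W).

(** The map [(a, b) |-> a W b^T - b W a^T] is alternating, so this is again the
identity between a rotation and its cofactors. *)
Lemma axial_rotation M W : is_rotation M ->
  axial (M^T *m W *m M) = axial W *m M.
Proof.
move=> [_ cofM]; apply/rowP => i; rewrite !mxE !sum3 !mxE !sum3.
rewrite -(cofM i0 i) -(cofM i1 i) -(cofM i2 i) !ordS3.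
rewrite !mxE; ring.
Qed.

Lemma contraction_rotation alpha n M W : is_rotation M ->
  contraction alpha (n *m M) (M^T *m W *m M) = contraction alpha n W.
Proof.
move=> rotM; rewrite /contraction axial_rotation // dot_rotation //.
have [MMT _] := rotM.
rewrite mxtrace_mulC !mulmxA MMT mul1mx trmx_mul.
by rewrite -!mulmxA (mulmxA M M^T) MMT mul1mx (mulmxA M M^T) MMT mul1mx.
Qed.

Section Wedge.
Variable k : nat.

(** The wedge product of [k] covectors evaluated on [k] fixed vectors; a
covector is represented by the row of its [k] values. *)
Definition wedge (l : seq 'rV[R]_k) : R := \det (\matrix_(a < k) l`_a).

Lemma wedge_scalar l1 l2 : (size l1 < k)%N ->
  scalar (fun x => wedge (l1 ++ x :: l2)).
Proof.
move=> lt1k a x y; set r := Ordinal lt1k.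
have tail_lift (z z' : 'rV[R]_k) (b : 'I_k.-1) :
    (l1 ++ z :: l2)`_(lift r b) = (l1 ++ z' :: l2)`_(lift r b).
  rewrite !nth_cat; case: ltnP => // le_b.
  have : (0 < lift r b - size l1)%N.
    rewrite subn_gt0 ltn_neqAle le_b andbT.
    by have := neq_lift r b; rewrite -val_eqE.
  by case: (_ - _)%N.
rewrite -[wedge (_ ++ y :: _)]mul1r.
apply: (determinant_multilinear (i0 := r)).
- by rewrite !rowK !nth_cat /= ltnn subnn /= scale1r.
- by apply/row_matrixP => b; rewrite !row_rowsub !rowK.
- by apply/row_matrixP => b; rewrite !row_rowsub !rowK.
Qed.

Lemma wedge_repeated l1 l2 x : ((size l1).+1 < k)%N ->
  wedge (l1 ++ [:: x, x & l2]) = 0.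
Proof.
move=> lt1k; have lt0k := ltnW lt1k.
apply: (@determinant_alternate _ _ _ (Ordinal lt0k) (Ordinal lt1k)).
  by rewrite -val_eqE /= neq_ltn leqnn.
by move=> j; rewrite !mxE !nth_cat /= ltnn subnn ltnNge leqnSn /= subSnn.
Qed.

Lemma wedge_alternating2 l1 l2 : ((size l1).+1 < k)%N ->
  alternating2 (fun x y => wedge (l1 ++ [:: x, y & l2])).
Proof.
move=> lt1k; split=> [y|x|x]; last exact: wedge_repeated.
  exact/wedge_scalar/ltnW.
move=> a y z; have := @wedge_scalar (rcons l1 x) l2.
by rewrite size_rcons => /(_ lt1k a y z); rewrite !cat_rcons.
Qed.

Lemma wedge_swap l1 l2 x y : ((size l1).+1 < k)%N ->
  wedge (l1 ++ [:: y, x & l2]) = - wedge (l1 ++ [:: x, y & l2]).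
Proof. by move=> /(wedge_alternating2 l2)/alternating2_swap->. Qed.

Lemma wedge_alternating3 l1 l2 : ((size l1).+2 < k)%N ->
  alternating3 (fun x y z => wedge (l1 ++ [:: x, y, z & l2])).
Proof.
move=> lt1k; split=> [x|z]; last exact/wedge_alternating2/ltnW.
have := @wedge_alternating2 (rcons l1 x) l2.
rewrite size_rcons => /(_ lt1k) [fl fr f0].
split=> [y a u w|y a u w|y].
- by have := fl y a u w; rewrite !cat_rcons.
- by have := fr y a u w; rewrite !cat_rcons.
- by have := f0 y; rewrite !cat_rcons.
Qed.

Lemma wedge_scale (l : seq (R * 'rV[R]_k)) : size l = k ->
  wedge [seq p.1 *: p.2 | p <- l] = \prod_(p <- l) p.1 * wedge (unzip2 l).
Proof.
move=> szl; rewrite /wedge.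
have -> : \matrix_(a < k) [seq p.1 *: p.2 | p <- l]`_a
        = diag_mx (\row_a (nth (0, 0) l a).1) *m (\matrix_(a < k) (unzip2 l)`_a).
  rewrite mul_diag_mx; apply/matrixP => a b; rewrite !mxE.
  by rewrite !(nth_map (0, 0)) ?szl // mxE.
rewrite det_mulmx det_diag; congr (_ * _).
rewrite (big_nth (0, 0)) szl big_mkord.
by apply: eq_bigr => a _; rewrite mxE.
Qed.

End Wedge.
End ThreeSpace.

(** * The invariant expressions *)

Section InvariantForm.
Set Implicit Arguments.
Unset Strict Implicit.
Unset Printing Implicit Defensive.
Variable R : realType.
Section Frame.
Variable k : nat.
Implicit Types (x v : 'I_3 -> 'rV[R]_k) (t p : 'rV[R]_k).

(** The rows [x], [t], [v], [p] stand for the differentials of position, time,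
velocity and pressure.  The rows with index [S i] and [S (S i)], cyclically,
give the 2-forms dual to the [i]-th axis. *)
Definition invariant_form (e : R) (n : 'rV[R]_3) x t v p : R :=
  let S := @ordS 3 in
  let W := @wedge R k in
  e * match k with
  | 2 => contraction 1 n (\matrix_(i, j) W [:: x i; v j]) + W [:: t; p]
  | 3 => dot n (\row_i W [:: x (S i); x (S (S i)); p])
         + dot n (\row_i W [:: t; v (S i); v (S (S i))])
  | 4 => contraction 2^-1 n
           (\matrix_(i, j) W [:: x (S i); x (S (S i)); v (S j); v (S (S j))])
         + contraction 1 n (\matrix_(i, j) W [:: x i; t; v j; p])
  | 5 => dot n (\row_i W [:: x i0; x i1; x i2; v i; p])
         + dot n (\row_i W [:: x i; t; v i0; v i1; v i2])
  | 6 => W [:: x i0; x i1; x i2; v i0; v i1; v i2]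
         + contraction 2^-1 n (\matrix_(i, j)
             W [:: x (S i); x (S (S i)); t; v (S j); v (S (S j)); p])
  | 8 => W [:: x i0; x i1; x i2; t; v i0; v i1; v i2; p]
  | _ => 0
  end.

(** The factors in each wedge product multiply to one. *)
Lemma invariant_form_scale e n a x t v p : a != 0 ->
  invariant_form e n (fun i => a *: x i) (a ^+ 2 *: t)
    (fun i => a^-1 *: v i) (a ^- 2 *: p)
  = invariant_form e n x t v p.
Proof.
move=> a0.
have scaleW (l : seq (R * 'rV[R]_k)) : size l = k ->
    \prod_(q <- l) q.1 = 1 ->
    wedge [seq q.1 *: q.2 | q <- l] = wedge (unzip2 l).
  by move=> szl prod1; rewrite wedge_scale // prod1 mul1r.
have prodE := (big_cons, big_nil).
rewrite /invariant_form; congr (_ * _).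
move: scaleW x v t p.
case: (k) => [|[|[|[|[|[|[|[|[|k0]]]]]]]]] scaleW x v t p //=.
- congr (contraction _ _ _ + _).
    apply/matrixP => i j; rewrite !mxE.
    apply: (scaleW [:: (a, x i); (a^-1, v j)]) => //.
    by rewrite !prodE /=; field.
  apply: (scaleW [:: (a ^+ 2, t); (a ^- 2, p)]) => //.
  by rewrite !prodE /=; field.
- congr (dot _ _ + dot _ _); apply/rowP => i; rewrite !mxE.
    apply: (scaleW [:: (a, _); (a, _); (a ^- 2, p)]) => //.
    by rewrite !prodE /=; field.
  apply: (scaleW [:: (a ^+ 2, _); (a^-1, _); (a^-1, _)]) => //.
  by rewrite !prodE /=; field.
- congr (contraction _ _ _ + contraction _ _ _);
    apply/matrixP => i j; rewrite !mxE.
    apply: (scaleW [:: (a, _); (a, _); (a^-1, _); (a^-1, _)]) => //.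
    by rewrite !prodE /=; field.
  apply: (scaleW [:: (a, _); (a ^+ 2, _); (a^-1, _); (a ^- 2, _)]) => //.
  by rewrite !prodE /=; field.
- congr (dot _ _ + dot _ _); apply/rowP => i; rewrite !mxE.
    apply: (scaleW [:: (a, _); (a, _); (a, _); (a^-1, _); (a ^- 2, p)]) => //.
    by rewrite !prodE /=; field.
  apply: (scaleW [:: (a, _); (a ^+ 2, _);
                     (a^-1, _); (a^-1, _); (a^-1, _)]) => //.
  by rewrite !prodE /=; field.
- congr (_ + contraction _ _ _).
    apply: (scaleW [:: (a, _); (a, _); (a, _);
                       (a^-1, _); (a^-1, _); (a^-1, _)]) => //.
    by rewrite !prodE /=; field.
  apply/matrixP => i j; rewrite !mxE.
  apply: (scaleW [:: (a, _); (a, _); (a ^+ 2, _);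
                     (a^-1, _); (a^-1, _); (a ^- 2, _)]) => //.
  by rewrite !prodE /=; field.
- apply: (scaleW [:: (a, _); (a, _); (a, _); (a ^+ 2, _);
                     (a^-1, _); (a^-1, _); (a^-1, _); (a ^- 2, _)]) => //.
  by rewrite !prodE /=; field.
Qed.

Lemma row_rotation (f : 'I_3 -> R) (M : 'M[R]_3) :
  \row_i (\sum_k M k i * f k) = (\row_i f i) *m M.
Proof.
by apply/rowP => i; rewrite !mxE; apply: eq_bigr => j _; rewrite mxE mulrC.
Qed.

Lemma matrix_rotation (f : 'I_3 -> 'I_3 -> R) (M : 'M[R]_3) :
  \matrix_(i, j) (\sum_k M k i * \sum_l M l j * f k l)
  = M^T *m (\matrix_(i, j) f i j) *m M.
Proof.
apply/matrixP => i j; rewrite -mulmxA !mxE; apply: eq_bigr => k' _.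
by rewrite !mxE; congr (_ * _); apply: eq_bigr => l _; rewrite mxE mulrC.
Qed.

(** Each wedge product is linear or alternating in its position slots and in its
velocity slots, so that the vectors and matrices of wedge products are
transformed by [M] exactly as [n] is; dot products and contractions are then
unchanged. *)
Lemma invariant_form_rotation e n M x t v p : is_rotation M ->
  invariant_form e (n *m M) (rotate M x) t (rotate M v) p
  = invariant_form e n x t v p.
Proof.
move=> rotM.
have dotE f g : (forall i, f i = \sum_k M k i * g k) ->
    dot (n *m M) (\row_i f i) = dot n (\row_i g i).
  move=> fE; rewrite -[RHS](dot_rotation _ _ rotM) -row_rotation.
  by congr (dot _ _); apply/rowP => i; rewrite !mxE.
have conE b f g :
    (forall i j, f i j = \sum_k M k i * \sum_l M l j * g k l) ->
    contraction b (n *m M) (\matrix_(i, j) f i j)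
    = contraction b n (\matrix_(i, j) g i j).
  move=> fE; rewrite -[RHS](contraction_rotation _ _ _ rotM) -matrix_rotation.
  by congr (contraction _ _ _); apply/matrixP => i j; rewrite !mxE.
rewrite /invariant_form; congr (_ * _).
move: x v t p; case: (k) => [|[|[|[|[|[|[|[|[|k0]]]]]]]]] x v t p //=.
- congr (_ + _); apply: conE => i j.
  rewrite (scalar_rotate M x i (@wedge_scalar R 2 [::] [:: _] isT)).
  apply: eq_bigr => a _; congr (_ * _).
  exact: (scalar_rotate M v j (@wedge_scalar R 2 [:: _] [::] isT)).
- congr (_ + _); apply: dotE => i.
    exact: (alternating2_rotate x i (@wedge_alternating2 R 3 [::] [:: p] isT)).
  exact: (alternating2_rotate v i (@wedge_alternating2 R 3 [:: t] [::] isT)).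
- congr (_ + _); apply: conE => i j.
    rewrite (alternating2_rotate x i
      (@wedge_alternating2 R 4 [::] [:: _; _] isT) rotM).
    apply: eq_bigr => a _; congr (_ * _).
    exact: (alternating2_rotate v j
      (@wedge_alternating2 R 4 [:: _; _] [::] isT)).
  rewrite (scalar_rotate M x i (@wedge_scalar R 4 [::] [:: _; _; _] isT)).
  apply: eq_bigr => a _; congr (_ * _).
  exact: (scalar_rotate M v j (@wedge_scalar R 4 [:: _; _] [:: _] isT)).
- congr (_ + _); apply: dotE => i.
    rewrite (alternating3_rotate x
      (@wedge_alternating3 R 5 [::] [:: _; p] isT)) //.
    exact: (scalar_rotate M v i
      (@wedge_scalar R 5 [:: _; _; _] [:: p] isT)).
  rewrite (alternating3_rotate v
    (@wedge_alternating3 R 5 [:: _; _] [::] isT)) //.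
  exact: (scalar_rotate M x i (@wedge_scalar R 5 [::] [:: _; _; _; _] isT)).
- congr (_ + _).
    rewrite (alternating3_rotate x
      (@wedge_alternating3 R 6 [::] [:: _; _; _] isT)) //.
    exact: (alternating3_rotate v
      (@wedge_alternating3 R 6 [:: _; _; _] [::] isT)).
  apply: conE => i j.
  rewrite (alternating2_rotate x i
    (@wedge_alternating2 R 6 [::] [:: _; _; _; _] isT) rotM).
  apply: eq_bigr => a _; congr (_ * _).
  exact: (alternating2_rotate v j
    (@wedge_alternating2 R 6 [:: _; _; _] [:: p] isT)).
- rewrite (alternating3_rotate x
    (@wedge_alternating3 R 8 [::] [:: _; _; _; _; _] isT)) //.
  exact: (alternating3_rotate v
    (@wedge_alternating3 R 8 [:: _; _; _; _] [:: p] isT)).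
Qed.
End Frame.
End InvariantForm.

(** * Normal form of the given forms *)

Section NormalForm.
Set Implicit Arguments.
Unset Strict Implicit.
Unset Printing Implicit Defensive.
Variable R : realType.

(** The positions in the coordinate list of [x, y, z] and of [u, v, w]. *)
Definition ix (i : 'I_3) : 'I_8 := @lshift 3 5 i.
Definition iv (i : 'I_3) : 'I_8 := @lshift 7 1 (@rshift 4 3 i).

Lemma ixE : (ix i0 = cx) * (ix i1 = cy) * (ix i2 = cz).
Proof. by do !split; exact: val_inj. Qed.

Lemma ivE : (iv i0 = cu) * (iv i1 = cv) * (iv i2 = cw).
Proof. by do !split; exact: val_inj. Qed.

Definition values k (V : 'I_k -> 'rV[R]_8) (c : 'I_8) : 'rV[R]_k :=
  \row_b V b 0 c.

Lemma dwedgeE k (I : k.-tuple 'I_8) (V : 'I_k -> 'rV[R]_8) :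
  dwedge I V = wedge [seq values V c | c <- I].
Proof.
congr (\det _); apply/matrixP => a b.
by rewrite !mxE (nth_map ord0) ?size_tuple // mxE (tnth_nth ord0).
Qed.

Definition direction (m : 'rV[R]_8) : 'rV[R]_3 := \row_i (m 0 (iv i) / speed m).

Lemma speed_sqr (m : 'rV[R]_8) :
  speed m ^+ 2 = m 0 cu ^+ 2 + m 0 cv ^+ 2 + m 0 cw ^+ 2.
Proof. by rewrite sqr_sqrtr // !addr_ge0 // sqr_ge0. Qed.

Lemma speed_neq0 (m : 'rV[R]_8) : nonzero_velocity m -> speed m != 0.
Proof.
move=> m0; apply/eqP => q0; apply: m0.
have := speed_sqr m; rewrite q0 expr0n /= => /esym/eqP.
by rewrite !paddr_eq0 ?addr_ge0 ?sqr_ge0 // !sqrf_eq0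
  => /andP[/andP[]] /eqP-> /eqP-> /eqP->.
Qed.

Lemma contraction3 alpha n (W : 'I_3 -> 'I_3 -> R) :
  contraction alpha n (\matrix_(i, j) W i j) =
  let a := n 0 i0 in let b := n 0 i1 in let c := n 0 i2 in
  alpha * (W i0 i0 + W i1 i1 + W i2 i2 +
  (a * a * W i0 i0 + b * b * W i1 i1 + c * c * W i2 i2
   + a * b * (W i0 i1 + W i1 i0) + a * c * (W i0 i2 + W i2 i0)
   + b * c * (W i1 i2 + W i2 i1)))
  + (a * (W i1 i2 - W i2 i1) + b * (W i2 i0 - W i0 i2)
     + c * (W i0 i1 - W i1 i0)).
Proof.
rewrite /contraction /dot /mxtrace !mxE !sum3 !mxE !sum3 !ordS3 !mxE /=; ring.
Qed.

(** Since [n] is a unit vector, a diagonal coefficient such as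
[1 - (u ^+ 2 + v ^+ 2) / (2 * q ^+ 2)] is half of [1 + (w / q) ^+ 2], as in
[contraction 2^-1].  The pair of axes [z], [x] is in cyclic order, whereas the
given forms use [dx /\ dz], whence the swaps in the proof. *)
Lemma B_invariant_form n (m : 'rV[R]_8) (V : 'I_n -> 'rV[R]_8) :
  n \in [:: 2; 3; 4; 5; 6; 8]%N -> nonzero_velocity m ->
  B R n m V = invariant_form (calE m) (direction m)
    (fun i => values V (ix i)) (values V ct)
    (fun i => values V (iv i)) (values V cp).
Proof.
move=> hn m0; have q0 := speed_neq0 m0.
have q2 := speed_sqr m.
have sq2 (a b c q : R) : q != 0 -> q ^+ 2 = a ^+ 2 + b ^+ 2 + c ^+ 2 ->
    1 - (a ^+ 2 + b ^+ 2) / (2 * q ^+ 2) = 2^-1 * (1 + c ^+ 2 / q ^+ 2).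
  move=> q_neq0 qE; have -> : a ^+ 2 + b ^+ 2 = q ^+ 2 - c ^+ 2.
    by rewrite qE addrK.
  by field.
have duv := sq2 _ _ _ _ q0 q2.
have duw := sq2 (m 0 cu) (m 0 cw) (m 0 cv) _ q0.
have dvw := sq2 (m 0 cv) (m 0 cw) (m 0 cu) _ q0.
rewrite -addrA (addrC (m 0 cw ^+ 2)) addrA in duw; have {}duw := duw q2.
rewrite addrC addrA in dvw; have {}dvw := dvw q2.
have dirE : (direction m 0 i0 = m 0 cu / speed m)
    * (direction m 0 i1 = m 0 cv / speed m)
    * (direction m 0 i2 = m 0 cw / speed m).
  by rewrite !mxE !ivE.
move: hn; rewrite !inE => /or4P[|||/or3P[]] /eqP nE; subst n;
rewrite /B /B2 /B3 /B4 /B5 /B6 /B8 /invariant_form /dot ?sum3 ?contraction3 ?mxE;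
rewrite ?sum3 !dwedgeE /= ?ordS3 ?ixE ?ivE ?dirE.
all: congr (_ * _).
all: move: (values V cx) (values V cy) (values V cz) (values V ct) => X Y Z T.
all: move: (values V cu) (values V cv) (values V cw) (values V cp) => X' Y' Z' P.
- by do !(move: (wedge _) => ?); field.
- rewrite (@wedge_swap R _ [::] [:: P] X Z) //.
  rewrite (@wedge_swap R _ [:: T] [::] X' Z') //.
  by do !(move: (wedge _) => ?); field.
- have swap l : wedge [:: Z, X & l] = - wedge [:: X, Z & l] :> R.
    exact: (@wedge_swap R 4 [::]).
  have swap' a b : wedge [:: a; b; Z'; X'] = - wedge [:: a; b; X'; Z'] :> R.
    exact: (@wedge_swap R 4 [:: a; b]).
  rewrite duv duw dvw !swap !swap'.
  by do !(move: (wedge _) => ?); field.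
- by do !(move: (wedge _) => ?); field.
- have swap l : wedge [:: Z, X & l] = - wedge [:: X, Z & l] :> R.
    exact: (@wedge_swap R 6 [::]).
  have swap' a b :
      wedge [:: a; b; T; Z'; X'; P] = - wedge [:: a; b; T; X'; Z'; P] :> R.
    exact: (@wedge_swap R 6 [:: a; b; T]).
  rewrite duv duw dvw !swap !swap'.
  by do !(move: (wedge _) => ?); field.
Qed.
End NormalForm.

(** * The symmetry group *)

Section Symmetries.
Set Implicit Arguments.
Unset Strict Implicit.
Unset Printing Implicit Defensive.
Variable R : realType.
Implicit Types (m y : 'rV[R]_8) (M : 'M[R]_3) (a b s : R).

Lemma coord8P (Q : 'I_8 -> Prop) :
  (forall i, Q (ix i)) -> Q ct -> (forall i, Q (iv i)) -> Q cp -> forall c, Q c.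
Proof.
move=> Qx Qt Qv Qp [c ltc].
have Q_ (d : 'I_8) : d = c :> nat -> Q d -> Q (Ordinal ltc).
  by move=> dE; rewrite (_ : Ordinal ltc = d) //; exact: val_inj.
move: c ltc Q_ => [|[|[|[|[|[|[|[|//]]]]]]]] ltc Q_.
- exact: (Q_ (ix i0)).
- exact: (Q_ (ix i1)).
- exact: (Q_ (ix i2)).
- exact: (Q_ ct).
- exact: (Q_ (iv i0)).
- exact: (Q_ (iv i1)).
- exact: (Q_ (iv i2)).
- exact: (Q_ cp).
Qed.

Definition position m : 'rV[R]_3 := \row_i m 0 (ix i).
Definition velocity m : 'rV[R]_3 := \row_i m 0 (iv i).

Lemma speedE m : speed m = Num.sqrt (dot (velocity m) (velocity m)).
Proof. by rewrite /speed /dot sum3 !mxE !ivE -!expr2. Qed.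

(** A similarity of velocity space turns the direction by its rotation part, and
[calE] does not change if the pressure is scaled by the square of the ratio. *)
Lemma similar_velocity m m' M a : 0 < a -> is_rotation M ->
  velocity m' = a *: (velocity m *m M) -> m' 0 cp = a ^+ 2 * m 0 cp ->
  [/\ speed m' = a * speed m, direction m' = direction m *m M
    & calE m' = calE m].
Proof.
move=> a_gt0 rotM vE pE.
have a0 : a != 0 by rewrite gt_eqF.
have qE : speed m' = a * speed m.
  rewrite !speedE vE.
  have -> : dot (a *: (velocity m *m M)) (a *: (velocity m *m M))
         = a ^+ 2 * dot (velocity m) (velocity m).
    rewrite -[in RHS](dot_rotation _ _ rotM) mulr_sumr; apply: eq_bigr => i _.
    by rewrite !mxE; ring.
  by rewrite sqrtrM ?sqr_ge0 // sqrtr_sqr gtr0_norm.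
split=> //.
  have dirE n : direction n = (speed n)^-1 *: velocity n.
    by apply/rowP => i; rewrite !mxE mulrC.
  rewrite !dirE vE qE invfM scalerA mulrAC mulVf // mul1r.
  by rewrite -scalemxAl.
by rewrite /calE pE qE exprMn invfM mulrACA divff ?mul1r // expf_neq0.
Qed.

Lemma velocity_neq0 m : velocity m != 0 <-> nonzero_velocity m.
Proof.
split=> [/eqP v0 [u0 v0' w0]|m0].
  by apply: v0; apply/rowP; apply: ord3P; rewrite !mxE ?ivE.
apply/eqP => /rowP v0; apply: m0.
by have := (v0 i0, v0 i1, v0 i2); rewrite !mxE !ivE => -[[-> ->] ->].
Qed.

(** The weights [1, 2, -1, -2] are those of the scaling field; matrices act on row
vectors from the right. *)
Definition linear_motion a M m : 'rV[R]_8 :=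
  let x := position m *m M in let v := velocity m *m M in
  \row_c [:: a * x 0 i0; a * x 0 i1; a * x 0 i2; a ^+ 2 * m 0 ct;
     a^-1 * v 0 i0; a^-1 * v 0 i1; a^-1 * v 0 i2; a ^- 2 * m 0 cp]`_c.

Definition motion a M b m : 'rV[R]_8 := linear_motion a M m + b *: partial R ct.

Lemma linear_motion_ix a M m i :
  linear_motion a M m 0 (ix i) = a * (position m *m M) 0 i.
Proof. by move: i; apply: ord3P; rewrite mxE. Qed.

Lemma linear_motion_iv a M m i :
  linear_motion a M m 0 (iv i) = a^-1 * (velocity m *m M) 0 i.
Proof. by move: i; apply: ord3P; rewrite mxE. Qed.

Lemma linear_motion_ct a M m : linear_motion a M m 0 ct = a ^+ 2 * m 0 ct.
Proof. by rewrite mxE. Qed.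

Lemma linear_motion_cp a M m : linear_motion a M m 0 cp = a ^- 2 * m 0 cp.
Proof. by rewrite mxE. Qed.

Definition linear_motionE :=
  (linear_motion_ix, linear_motion_iv, linear_motion_ct, linear_motion_cp).

Lemma partial_ctE :
  ((forall i, partial R ct 0 (ix i) = 0) * (forall i, partial R ct 0 (iv i) = 0)
  * (partial R ct 0 ct = 1) * (partial R ct 0 cp = 0))%type.
Proof.
by do !split; rewrite ?mxE //; apply: ord3P; rewrite !mxE.
Qed.

Lemma motion_ix a M b m i :
  motion a M b m 0 (ix i) = a * (position m *m M) 0 i.
Proof. by rewrite mxE linear_motionE [X in _ + X]mxE !partial_ctE mulr0 addr0.
Qed.

Lemma motion_iv a M b m i :
  motion a M b m 0 (iv i) = a^-1 * (velocity m *m M) 0 i.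
Proof. by rewrite mxE linear_motionE [X in _ + X]mxE !partial_ctE mulr0 addr0.
Qed.

Lemma motion_ct a M b m : motion a M b m 0 ct = a ^+ 2 * m 0 ct + b.
Proof. by rewrite mxE linear_motionE [X in _ + X]mxE !partial_ctE mulr1. Qed.

Lemma motion_cp a M b m : motion a M b m 0 cp = a ^- 2 * m 0 cp.
Proof. by rewrite mxE linear_motionE [X in _ + X]mxE !partial_ctE mulr0 addr0.
Qed.

Definition motionE := (motion_ix, motion_iv, motion_ct, motion_cp).

Lemma linear_motion_linear a M : linear (linear_motion a M).
Proof.
move=> k m y.
have posD : position (k *: m + y) = k *: position m + position y.
  by apply/rowP => i; rewrite !mxE.
have velD : velocity (k *: m + y) = k *: velocity m + velocity y.
  by apply/rowP => i; rewrite !mxE.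
have combE p (A B : 'rV[R]_p) c : (k *: A + B) 0 c = k * A 0 c + B 0 c.
  by rewrite !mxE.
apply/rowP; apply: coord8P => [i||i|]; rewrite combE !linear_motionE.
- by rewrite posD mulmxDl -scalemxAl combE; ring.
- by rewrite combE; ring.
- by rewrite velD mulmxDl -scalemxAl combE; ring.
- by rewrite combE; ring.
Qed.

Lemma motion_similar a M b m : 0 < a -> is_rotation M ->
  [/\ speed (motion a M b m) = a^-1 * speed m,
      direction (motion a M b m) = direction m *m M
    & calE (motion a M b m) = calE m].
Proof.
move=> a_gt0 rotM; apply: similar_velocity => //; first by rewrite invr_gt0.
  by apply/rowP => i; rewrite [LHS]mxE motionE [RHS]mxE.
by rewrite motionE exprVn.
Qed.

Lemma B_motion n a M b m (V : 'I_n -> 'rV[R]_8) :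
  n \in [:: 2; 3; 4; 5; 6; 8]%N -> nonzero_velocity m ->
  0 < a -> is_rotation M ->
  B R n (motion a M b m) (fun i => linear_motion a M (V i)) = B R n m V.
Proof.
move=> hn m0 a_gt0 rotM; have a0 : a != 0 by rewrite gt_eqF.
have [qE dE eE] := motion_similar b m a_gt0 rotM.
rewrite !B_invariant_form //; last first.
  apply/velocity_neq0; apply/eqP => v0; have := speedE (motion a M b m).
  rewrite v0 qE /dot big1 => [|i _]; last by rewrite !mxE mul0r.
  move/eqP; rewrite sqrtr0 mulf_eq0 invr_eq0 (negbTE a0).
  by rewrite (negbTE (speed_neq0 m0)).
rewrite dE eE -[RHS](invariant_form_rotation _ _ _ _ _ _ rotM).
rewrite -[RHS](invariant_form_scale _ _ _ _ _ _ a0).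
congr invariant_form.
- apply/funext => i; apply/rowP => j.
  rewrite [LHS]mxE linear_motionE [RHS]mxE; congr (_ * _).
  rewrite mxE /rotate summxE; apply: eq_bigr => l _.
  by rewrite !mxE mulrC.
- by apply/rowP => j; rewrite [LHS]mxE linear_motionE !mxE.
- apply/funext => i; apply/rowP => j.
  rewrite [LHS]mxE linear_motionE [RHS]mxE; congr (_ * _).
  rewrite mxE /rotate summxE; apply: eq_bigr => l _.
  by rewrite !mxE mulrC.
- by apply/rowP => j; rewrite [LHS]mxE linear_motionE !mxE.
Qed.

(** A linear map on row vectors is a finite sum of coordinates times constant
vectors. *)
Lemma linear_rV_differentiable n p
    (f : {linear 'rV[R]_n.+1 -> 'rV[R]_p.+1}) x :
  differentiable f x.
Proof.
have -> : (f : _ -> _) = \sum_i (fun z : 'rV[R]_n.+1 => z 0 i *: f (delta_mx 0 i)).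
  apply/funext => z; rewrite {1}(row_sum_delta z) linear_sum fct_sumE.
  by apply: eq_bigr => i _; rewrite linearZ.
apply: differentiable_sum => i; apply: differentiableZl.
exact: differentiable_coord.
Qed.

Lemma is_diff_motion a M b y :
  is_diff y (motion a M b) (linear_motion a M).
Proof.
pose L : {linear 'rV[R]_8 -> 'rV[R]_8} :=
  HB.pack (linear_motion a M)
    (GRing.isLinear.Build R 'rV[R]_8 'rV[R]_8 _ _ (@linear_motion_linear a M)).
have dL z : differentiable L z by exact: linear_rV_differentiable.
have cL : continuous L by move=> z; exact: differentiable_continuous.
have diffL : is_diff y L L by apply: DiffDef => //; exact: diff_lin.
have := @is_diffD _ _ _ L (cst (b *: partial R ct)) L 0 y diffL (is_diff_cst _ _).
by rewrite addr0.
Qed.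

Lemma is_derive_row n (f : R -> 'rV[R]_n.+1) (df : 'rV[R]_n.+1) s :
  (forall c, is_derive s 1 (fun r => f r 0 c) (df 0 c)) -> is_derive s 1 f df.
Proof.
move=> fE.
have der : derivable f s 1.
  by apply/derivable_mxP => i c; rewrite ord1; case: (fE c).
split=> //; rewrite derive_mx //; apply/rowP => c; rewrite mxE.
by case: (fE c).
Qed.

(** The family of motions is a global flow of [X], and by [B_motion] the pullback
of the form along it is constant. *)
Lemma lie_derivative_motion n (X : 'rV[R]_8 -> 'rV[R]_8) m
    (a b : R -> R) (M : R -> 'M[R]_3) :
  n \in [:: 2; 3; 4; 5; 6; 8]%N -> nonzero_velocity m ->
  (forall s, 0 < a s) -> (forall s, is_rotation (M s)) ->
  a 0 = 1 -> M 0 = 1%:M -> b 0 = 0 ->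
  (forall s y c, is_derive s 1 (fun r => motion (a r) (M r) (b r) y 0 c)
                   (X (motion (a s) (M s) (b s) y) 0 c)) ->
  is_lie_derivative X (B R n) m (fun _ => 0).
Proof.
move=> hn m0 a_gt0 rotM a0 M0 b0 derX.
exists (fun s => motion (a s) (M s) (b s)); split; last first.
  move=> V.
  have -> : (fun s => pullback (motion (a s) (M s) (b s)) (B R n) m V)
            = cst (B R n m V).
    apply/funext => s; have dE := is_diff_motion (a s) (M s) (b s) m.
    by rewrite /pullback diff_val B_motion.
  exact: is_derive_cst.
split.
- near=> y; apply/rowP; apply: coord8P => [i||i|]; rewrite motionE a0 ?b0 ?M0.
  + by rewrite mulmx1 mxE mul1r.
  + by rewrite expr1n mul1r addr0.
  + by rewrite mulmx1 mxE invr1 mul1r.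
  + by rewrite expr1n invr1 mul1r.
- near=> s y; apply: is_derive_row => c; exact: derX.
- near=> s y; by case: (is_diff_motion (a s) (M s) (b s) y).
Unshelve. all: by end_near. Qed.

End Symmetries.

(** * The one-parameter subgroups *)

Section Fields.
Set Implicit Arguments.
Unset Strict Implicit.
Unset Printing Implicit Defensive.
Variable R : realType.
Implicit Types (m y : 'rV[R]_8) (a b s : R).

Lemma is_rotation1 : is_rotation (1%:M : 'M[R]_3).
Proof.
split=> [|k i]; first by rewrite trmx1 mulmx1.
by move: k i; do 2![apply: ord3P]; rewrite !ordS3 !mxE /=; ring.
Qed.

Lemma is_derive_expM (k c s : R) :
  is_derive s 1 (fun r => expR (k * r) * c) (k * (expR (k * s) * c)).
Proof.
have -> : (fun r => expR (k * r) * c) = c *: (@expR R \o k *: id).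
  by apply/funext => r /=; rewrite mulrC.
apply: is_derive_eq; rewrite /= /GRing.scale /= mulr1; ring.
Qed.

Lemma is_derive_trig (A B C s : R) :
  is_derive s 1 (fun r => cos r * A + sin r * B + C) (- sin s * A + cos s * B).
Proof.
have dA := is_deriveZ A (is_derive_cos s).
have dB := is_deriveZ B (is_derive_sin s).
have := is_deriveD (is_deriveD dA dB) (is_derive_cst C s 1).
rewrite addr0 /GRing.scale /= mulrC (mulrC B) => d.
rewrite (_ : (fun _ => _) = (A \*: cos + B \*: sin + cst C)) //.
by apply/funext => r; rewrite !fctE /GRing.scale /= mulrC (mulrC _ B).
Qed.

(** The rotation by the angle [r] about the [k]-th axis is
[axis_rotation k (cos r) (sin r)] (Rodrigues' formula); its infinitesimal
generator is the matrix of the cross product with the [k]-th basis vector. *)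
Definition axis_generator (k : 'I_3) : 'M[R]_3 :=
  delta_mx (ordS k) (ordS (ordS k)) - delta_mx (ordS (ordS k)) (ordS k).

Definition axis_rotation (k : 'I_3) (c s : R) : 'M[R]_3 :=
  c *: (1%:M - delta_mx k k) + s *: axis_generator k + delta_mx k k.

Lemma axis_rotationP k c s : c ^+ 2 + s ^+ 2 = 1 ->
  is_rotation (axis_rotation k c s).
Proof.
move=> cs; have {}cs : c ^+ 2 = 1 - s ^+ 2 by rewrite -cs addrK.
split=> [|l i].
  apply/matrixP => l i; rewrite !mxE sum3 !mxE.
  by move: k l i; do 3![apply: ord3P]; rewrite ?ordS3 /=; ring: cs.
rewrite !mxE.
by move: k l i; do 3![apply: ord3P]; rewrite ?ordS3 /=; ring: cs.
Qed.

Lemma axis_rotation_generator k c s :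
  axis_rotation k c s *m axis_generator k
  = c *: axis_generator k - s *: (1%:M - delta_mx k k).
Proof.
apply/matrixP => l i; rewrite !mxE sum3 !mxE.
by move: k l i; do 3![apply: ord3P]; rewrite ?ordS3 /=; ring.
Qed.

Section Degree.
Variables (n : nat) (hn : n \in [:: 2; 3; 4; 5; 6; 8]%N).
Variables (m : 'rV[R]_8) (m0 : nonzero_velocity m).

Lemma lie_derivative_T : is_lie_derivative (@field_T R) (B R n) m (fun _ => 0).
Proof.
apply: (@lie_derivative_motion R n _ m (fun=> 1) id (fun=> 1%:M)) => //.
  by move=> s; exact: is_rotation1.
move=> s y; apply: coord8P => [i||i|]; rewrite partial_ctE.
- under eq_fun do rewrite motionE; exact: is_derive_cst.
- under eq_fun do rewrite motionE.
  have -> : (fun x => 1 ^+ 2 * y 0 ct + id x) = cst (y 0 ct) + id.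
    by apply/funext => x; rewrite !fctE expr1n mul1r.
  by apply: is_derive_eq; rewrite add0r.
- under eq_fun do rewrite motionE; exact: is_derive_cst.
- under eq_fun do rewrite motionE; exact: is_derive_cst.
Qed.

Lemma field_XE y :
  [/\ forall i, field_X y 0 (ix i) = y 0 (ix i),
      forall i, field_X y 0 (iv i) = - y 0 (iv i),
      field_X y 0 ct = 2 * y 0 ct & field_X y 0 cp = - (2 * y 0 cp)].
Proof.
split; rewrite /field_X /partial ?mxE /=; last 2 first.
- ring.
- ring.
- by apply: ord3P; rewrite !mxE ?ixE /=; ring.
- by apply: ord3P; rewrite !mxE ?ivE /=; ring.
Qed.

(** The flow is the scaling by [expR s], and each coordinate of it is an exponential
in [s]. *)
Lemma lie_derivative_X : is_lie_derivative (@field_X R) (B R n) m (fun _ => 0).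
Proof.
apply: (@lie_derivative_motion R n _ m (@expR R) (fun=> 0) (fun=> 1%:M)) => //.
- exact: expR_gt0.
- by move=> s; exact: is_rotation1.
- exact: expR0.
have expE (c d : R) (f : R -> R) s : f =1 (fun r => expR (c * r) * d) ->
    is_derive s 1 f (c * f s).
  by move=> fE; rewrite (funext fE); exact: is_derive_expM.
have exp2 r : expR r ^+ 2 = expR (2 * r) by rewrite mulr_natl mulr2n expRD.
move=> s y; set z := motion _ _ _ y; have [Xx Xv Xt Xp] := field_XE z.
apply: coord8P => [i||i|]; rewrite ?Xx ?Xv ?Xt ?Xp /z.
- rewrite -[X in is_derive _ _ _ X]mul1r; apply: expE => r.
  by rewrite motionE mul1r.
- by apply: expE => r; rewrite motionE addr0 exp2.
- rewrite -mulN1r; apply: expE => r.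
  by rewrite motionE mulN1r expRN.
- rewrite -mulNr; apply: expE => r.
  by rewrite motionE mulNr expRN exp2.
Qed.

Lemma lie_derivative_axis (k : 'I_3) (X : 'rV[R]_8 -> 'rV[R]_8) :
  (forall y i, X y 0 (ix i) = (position y *m axis_generator k) 0 i) ->
  (forall y i, X y 0 (iv i) = (velocity y *m axis_generator k) 0 i) ->
  (forall y, X y 0 ct = 0) -> (forall y, X y 0 cp = 0) ->
  is_lie_derivative X (B R n) m (fun _ => 0).
Proof.
move=> Xx Xv Xt Xp; pose M s := axis_rotation k (cos s) (sin s).
have rotE (a : 'rV[R]_3) s i : is_derive s 1 (fun r => (a *m M r) 0 i)
    ((a *m M s *m axis_generator k) 0 i).
  set P : 'M[R]_3 := 1%:M - delta_mx k k.
  have -> : (fun r => (a *m M r) 0 i) = fun r => cos r * (a *m P) 0 i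
      + sin r * (a *m axis_generator k) 0 i + (a *m delta_mx k k) 0 i.
    apply/funext => r; rewrite /M /axis_rotation -/P mulmxDr mulmxDr -!scalemxAr.
    by move: (a *m P) (a *m axis_generator k) (a *m _) => p g q; rewrite !mxE.
  have -> : (a *m M s *m axis_generator k) 0 i
      = - sin s * (a *m P) 0 i + cos s * (a *m axis_generator k) 0 i.
    rewrite -mulmxA axis_rotation_generator mulmxBr -!scalemxAr -/P.
    by move: (a *m P) (a *m axis_generator k) => p g; rewrite !mxE; ring.
  exact: is_derive_trig.
apply: (@lie_derivative_motion R n _ m (fun=> 1) (fun=> 0) M) => //.
- by move=> s; apply: axis_rotationP; exact: cos2Dsin2.
- by rewrite /M cos0 sin0 /axis_rotation scale1r scale0r addr0 subrK.
move=> s y; apply: coord8P => [i||i|]; rewrite ?Xx ?Xv ?Xt ?Xp.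
- under eq_fun do rewrite motionE mul1r.
  have -> : position (motion 1 (M s) 0 y) = position y *m M s.
    by apply/rowP => j; rewrite [LHS]mxE motionE mul1r.
  exact: rotE.
- under eq_fun do rewrite motionE; exact: is_derive_cst.
- under eq_fun do rewrite motionE invr1 mul1r.
  have -> : velocity (motion 1 (M s) 0 y) = velocity y *m M s.
    by apply/rowP => j; rewrite [LHS]mxE motionE invr1 mul1r.
  exact: rotE.
- under eq_fun do rewrite motionE; exact: is_derive_cst.
Qed.

Lemma lie_derivative_Rx : is_lie_derivative (@field_Rx R) (B R n) m (fun _ => 0).
Proof.
apply: (@lie_derivative_axis i0) => y; rewrite /field_Rx /partial.
- by apply: ord3P; rewrite !mxE sum3 !mxE !ordS3 !ixE /=; ring.
- by apply: ord3P; rewrite !mxE sum3 !mxE !ordS3 !ivE /=; ring.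
- by rewrite !mxE /=; ring.
- by rewrite !mxE /=; ring.
Qed.

Lemma lie_derivative_Ry : is_lie_derivative (@field_Ry R) (B R n) m (fun _ => 0).
Proof.
apply: (@lie_derivative_axis i1) => y; rewrite /field_Ry /partial.
- by apply: ord3P; rewrite !mxE sum3 !mxE !ordS3 !ixE /=; ring.
- by apply: ord3P; rewrite !mxE sum3 !mxE !ordS3 !ivE /=; ring.
- by rewrite !mxE /=; ring.
- by rewrite !mxE /=; ring.
Qed.

Lemma lie_derivative_Rz : is_lie_derivative (@field_Rz R) (B R n) m (fun _ => 0).
Proof.
apply: (@lie_derivative_axis i2) => y; rewrite /field_Rz /partial.
- by apply: ord3P; rewrite !mxE sum3 !mxE !ordS3 !ixE /=; ring.
- by apply: ord3P; rewrite !mxE sum3 !mxE !ordS3 !ivE /=; ring.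
- by rewrite !mxE /=; ring.
- by rewrite !mxE /=; ring.
Qed.
End Degree.

(** * Self-similar solutions *)

(** Both fields are homogeneous in [1 / t] at a fixed place. *)
Lemma substitute_similar (U : 'rV[R]_4 -> 'rV[R]_3) (P : 'rV[R]_4 -> R)
    (x y z t1 t2 : R) :
  self_similar U P -> x != 0 -> 0 < t1 -> 0 < t2 ->
  let m1 := substitute U P x y z t1 in let m2 := substitute U P x y z t2 in
  velocity m1 = (t2 / t1) *: velocity m2
  /\ m1 0 cp = (t2 / t1) ^+ 2 * m2 0 cp.
Proof.
move=> [F [G UP]] x0 t1_gt0 t2_gt0 m1 m2.
have [U1 P1] := UP x y z t1 t1_gt0 x0.
have [U2 P2] := UP x y z t2 t2_gt0 x0.
have t10 : t1 != 0 by rewrite gt_eqF.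
have t20 : t2 != 0 by rewrite gt_eqF.
split; last by rewrite !mxE /= P1 P2; field; rewrite t20 t10.
by apply/rowP; apply: ord3P; rewrite !mxE /= U1 U2 !mxE; field; rewrite t20 t10.
Qed.

Lemma velocity_substitute (U : 'rV[R]_4 -> 'rV[R]_3) (P : 'rV[R]_4 -> R)
    (x y z t : R) :
  velocity (substitute U P x y z t) = U (event x y z t).
Proof.
by apply/rowP; apply: ord3P; rewrite !mxE /=; congr (U _ 0 _); exact: val_inj.
Qed.

Lemma B_similar n (m m' : 'rV[R]_8) (V : 'I_n -> 'rV[R]_8) a :
  n \in [:: 2; 3; 4; 5; 6; 8]%N -> 0 < a ->
  nonzero_velocity m -> nonzero_velocity m' ->
  velocity m' = a *: velocity m -> m' 0 cp = a ^+ 2 * m 0 cp ->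
  B R n m' V = B R n m V.
Proof.
move=> hn a_gt0 m0 m'0 vE pE; rewrite !B_invariant_form //.
have [] := similar_velocity a_gt0 is_rotation1 _ pE.
  by rewrite mulmx1.
by rewrite mulmx1 => _ -> ->.
Qed.
End Fields.

Theorem mainTheorem6 (R : realType) (n : nat)
  (hn : n \in [:: 2; 3; 4; 5; 6; 8]%N) :
  (forall m : 'rV[R]_8, nonzero_velocity m ->
     [/\ is_lie_derivative (@field_T R) (B R n) m (fun _ => 0),
         is_lie_derivative (@field_X R) (B R n) m (fun _ => 0),
         is_lie_derivative (@field_Rx R) (B R n) m (fun _ => 0),
         is_lie_derivative (@field_Ry R) (B R n) m (fun _ => 0) &
         is_lie_derivative (@field_Rz R) (B R n) m (fun _ => 0)])
  /\
  (forall (nu : R) (U : 'rV[R]_4 -> 'rV[R]_3) (P : 'rV[R]_4 -> R),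
     (forall x y z t : R, 0 < t -> x != 0 -> U (event x y z t) != 0 ->
        navier_stokes_at nu U P (event x y z t)) ->
     self_similar U P ->
     forall (I : n.-tuple 'I_8) (x y z t1 t2 : R),
       x != 0 -> 0 < t1 -> 0 < t2 ->
       U (event x y z t1) != 0 -> U (event x y z t2) != 0 ->
       coefficient (B R n) I (substitute U P x y z t1)
       = coefficient (B R n) I (substitute U P x y z t2)).
Proof.
split=> [m m0|nu U P _ simUP I x y z t1 t2 x0 t1_gt0 t2_gt0 U1 U2].
  split.
  - exact: lie_derivative_T.
  - exact: lie_derivative_X.
  - exact: lie_derivative_Rx.
  - exact: lie_derivative_Ry.
  - exact: lie_derivative_Rz.
have [vE pE] := substitute_similar y z simUP x0 t1_gt0 t2_gt0.
apply: (B_similar _ hn _ _ _ vE pE); first exact: divr_gt0.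
  by apply/velocity_neq0; rewrite velocity_substitute.
by apply/velocity_neq0; rewrite velocity_substitute.
Qed.
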